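(* Let $\mathbb{G}=\mathbb{Z}_{\mathsf m_1}\times\cdots\times\mathbb{Z}_{\mathsf m_n}$ with $\mathsf m_i\mid\mathsf m_{i+1}$, let $\Phi_{\underline{\mathbf a}}$ ($\underline{\mathbf a}\in A$) be a non-abelian $3$-cocycle on $\mathbb{G}$ and let $G$ be an arbitrary finite abelian group. Suppose that there is a group epimorphism $\pi:G\twoheadrightarrow\mathbb{G}$. Then $\pi^*(\Phi_{\underline{\mathbf a}})$, $(g,h,z)\mapsto\Phi_{\underline{\mathbf a}}(\pi(g),\pi(h),\pi(z))$, is not a coboundary on $G$.
   Context: $\mathbf{k}$ is an algebraically closed field of characteristic zero; cocycles have values in the trivial module $\mathbf{k}^*$. $\mathsf g_i$ is a generator of $\mathbb{Z}_{\mathsf m_i}$, $\zeta_m$ a fixed primitive $m$-th root of unity for each $m$, $[x]$ the integer part of $x$. $A$ is the set of integer sequences $\underline{\mathbf a}=((a_l),(a_{st})_{s<t},(a_{rst})_{r<s<t})$, indices in $\{1,\dots,n\}$, with $0\le a_l<\mathsf m_l$, $0\le a_{st}<\gcd(\mathsf m_s,\mathsf m_t)$, $0\le a_{rst}<\gcd(\mathsf m_r,\mathsf m_s,\mathsf m_t)$. For $0\le i_l,j_l,k_l<\mathsf m_l$, $$\Phi_{\underline{\mathbf a}}\big(\textstyle\prod\mathsf g_l^{i_l},\prod\mathsf g_l^{j_l},\prod\mathsf g_l^{k_l}\big)=\prod_{l}\zeta_{\mathsf m_l}^{a_li_l[\frac{j_l+k_l}{\mathsf m_l}]}\prod_{s<t}\zeta_{\mathsf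 m_t}^{a_{st}i_t[\frac{j_s+k_s}{\mathsf m_s}]}\prod_{r<s<t}\zeta_{(\mathsf m_r,\mathsf m_s,\mathsf m_t)}^{-a_{rst}k_rj_si_t}.$$ A $3$-cocycle $\Phi$ on $\mathbb{G}$ is called abelian if the twisted quantum double $D^\Phi(\mathbb{G})$ is a commutative algebra; for the abelian group $\mathbb{G}$ this is the vector space with basis $e(g)\otimes x$ ($g,x\in\mathbb{G}$) and multiplication $(e(g)\otimes x)(e(h)\otimes y)=\theta_g(x,y)\delta_{g,h}\,e(g)\otimes xy$, where $\theta_g(x,y)=\frac{\Phi(g,x,y)\Phi(x,y,g)}{\Phi(x,g,y)}$. A $3$-cocycle on $G$ is a coboundary if it equals $\frac{J(b,c)J(a,bc)}{J(ab,c)J(a,b)}$ for some $J:G\times G\to\mathbf{k}^*$. *)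

(* Defs.v *)
From HB Require Import structures.
From mathcomp Require Import all_boot all_order all_fingroup all_algebra.
Set Implicit Arguments.
Unset Strict Implicit.
Unset Printing Implicit Defensive.

Import GroupScope GRing.Theory.
Local Open Scope ring_scope.

(* The direct product Z_(m 0) x ... x Z_(m (n - 1)), with its componentwise
   group law (written multiplicatively).  The type 'I_p.-1.+1 is the cyclic
   group of order p for every p > 0, including p = 1; 'Z_p would be wrong
   there. *)
Definition zprod (n : nat) (m : 'I_n -> nat) : finGroupType :=
  {dffun forall l : 'I_n, 'I_(m l).-1.+1}.

(* The l-th component of g, as a natural number in [0, m l). *)
Definition zexp (n : nat) (m : 'I_n -> nat) (g : zprod m) (l : 'I_n) : nat :=
  nat_of_ord (g l).

Definition zgen (n : nat) (m : 'I_n -> nat) (l : 'I_n) : zprod m :=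
  dfung1 (inZp 1 : 'I_(m l).-1.+1).

(* The components of g are its exponents on the standard generators. *)
Lemma zprod_gen (n : nat) (m : 'I_n -> nat) (g : zprod m) :
  g = (\prod_(l < n) zgen m l ^+ zexp g l)%g.
Proof.
apply/ffunP => j.
rewrite (big_morph (fun x : zprod m => x j) (dffunM j) (_ : _ = 1%g)) ?ffunE//.
rewrite (eq_bigr (fun l => if l == j then g j else 1%g)) => [|l _].
  by rewrite -big_mkcond /= big_pred1_eq.
rewrite -[LHS]/(dffun_morphism _ j (zgen m l ^+ zexp g l)%g).
rewrite morphX ?inE//=; case: eqVneq => [->|ne_lj].
  rewrite dfung1_id Zp_expg /zexp; apply/val_inj => /=.
  by rewrite modnMml mul1n modn_small.
by rewrite dfung1_dflt// expg1n.
Qed.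

Record exponents (n : nat) : Type := Exponents {
  a1 : 'I_n -> nat;
  a2 : 'I_n -> 'I_n -> nat;
  a3 : 'I_n -> 'I_n -> 'I_n -> nat
}.

(* Only the values a2 s t for s < t and a3 r s t for r < s < t matter. *)
Definition in_A (n : nat) (m : 'I_n -> nat) (a : exponents n) : Prop :=
  [/\ forall l : 'I_n, (a1 a l < m l)%N,
      forall s t : 'I_n, (s < t)%N -> (a2 a s t < gcdn (m s) (m t))%N
    & forall r s t : 'I_n, (r < s)%N -> (s < t)%N ->
        (a3 a r s t < gcdn (gcdn (m r) (m s)) (m t))%N].

Section Cochains.

Variable k : fieldType.

Definition Phi (n : nat) (m : 'I_n -> nat) (zeta : nat -> k) (a : exponents n)
    (x y z : zprod m) : k :=
  let i := zexp x in let j := zexp y in let h := zexp z in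
  (\prod_(l < n) zeta (m l) ^+ (a1 a l * i l * ((j l + h l) %/ m l)))
  * (\prod_(s < n) \prod_(t < n | (s < t)%N)
       zeta (m t) ^+ (a2 a s t * i t * ((j s + h s) %/ m s)))
  * (\prod_(r < n) \prod_(s < n | (r < s)%N) \prod_(t < n | (s < t)%N)
       zeta (gcdn (gcdn (m r) (m s)) (m t)) ^- (a3 a r s t * h r * j s * i t)).

(* 3-coboundaries on G with values in the trivial module k^*. *)
Definition coboundary3 (gT : finGroupType) (G : {group gT})
    (F : gT -> gT -> gT -> k) : Prop :=
  exists2 J : gT -> gT -> k,
    {in G &, forall x y, J x y != 0}
  & {in G & G & G, forall a b c,
      F a b c = (J b c * J a (b * c)%g) / (J (a * b)%g c * J a b)}.

Section TwistedDouble.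

Variables (gT : finGroupType) (F : gT -> gT -> gT -> k).

Definition theta (g x y : gT) : k := (F g x y * F x y g) / F x g y.

(* The underlying vector space of the twisted quantum double: a vector is the
   family of its coordinates on the basis e(g) (x) x. *)
Definition tdouble := {ffun gT * gT -> k^o}.

Definition tdbasis (g x : gT) : tdouble := [ffun p => (p == (g, x))%:R].

Definition tdmul (u v : tdouble) : tdouble :=
  \sum_(p : gT * gT) \sum_(q : gT * gT)
    (u p * v q) *:
      ((theta p.1 p.2 q.2 * (p.1 == q.1)%:R) *: tdbasis p.1 (p.2 * q.2)%g).

(* This is the product of the twisted double only when gT is abelian, which is
   the only case in which it is used. *)
Definition abelian_cocycle : Prop := commutative tdmul.

End TwistedDouble.

End Cochains.

(* Main.v *)
Require Import Defs.
From mathcomp Require Import all_boot all_order all_fingroup all_algebra.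
From mathcomp Require Import ring.
Import GroupScope GRing.Theory.
Local Open Scope ring_scope.

(** The twisted double of an abelian group is commutative as soon as every
    theta_g is a symmetric function, and the obstruction to this symmetry is

      theta_g(x,y) / theta_g(y,x)
        = F(g,x,y) F(x,y,g) F(y,g,x) / (F(x,g,y) F(g,y,x) F(y,x,g)),

    the product of F over the six permutations of (g,x,y), each factor raised
    to the sign of its permutation.  On an abelian group this alternating
    product kills every coboundary: in

      F(a,b,c) = J(b,c) J(a,bc) / (J(ab,c) J(a,b)),

    the factors J(a,bc) and J(ab,c) are each invariant under a transposition of
    the arguments, and J(b,c) is carried to J(a,b) by a 3-cycle, which is even
    ([coboundary3_theta_sym]).

    The alternating product is moreover natural under pullback.  So if the
    pullback of Phi along an epimorphism from an abelian group is a coboundary,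
    then theta is symmetric for Phi itself, since every triple of elements of
    the target lifts; and Phi is then abelian
    ([theta_sym_abelian_cocycle]). *)

(** The quotient of the two sides is the alternating product of [F] over the
    permutations of (g, x, y), in which the values of [J] cancel in pairs. *)
Lemma coboundary3_theta_sym (k : fieldType) (gT : finGroupType)
    (G : {group gT}) (F : gT -> gT -> gT -> k) :
  abelian G -> coboundary3 G F ->
  {in G & G & G, forall g x y, theta F g x y = theta F g y x}.
Proof.
move=> /centsP abG [J J0 FE] g x y Gg Gx Gy; rewrite /theta !FE//.
(* Commutativity makes the products of two arguments agree, so that the
   identity becomes one between rational functions in the values of [J]. *)
rewrite (abG x Gx g Gg) (abG y Gy g Gg) (abG y Gy x Gx).
by field; rewrite !J0 ?groupM.
Qed.

Lemma theta_sym_abelian_cocycle (k : fieldType) (gT : finGroupType)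
    (F : gT -> gT -> gT -> k) :
  abelian [set: gT] -> (forall g x y, theta F g x y = theta F g y x) ->
  abelian_cocycle F.
Proof.
move=> abT thC u v; rewrite /tdmul exchange_big /=.
apply: eq_bigr => -[h y] _; apply: eq_bigr => -[g x] _ /=.
rewrite (mulrC (u _)); case: eqVneq => [->|_].
  by rewrite thC (centsP abT x _ y) ?inE.
by rewrite !mulr0 !scale0r.
Qed.

Lemma zprod_abelian (n : nat) (m : 'I_n -> nat) : abelian [set: zprod m].
Proof.
apply/centsP => x _ y _; apply/ffunP => l.
by rewrite !dffunM; apply: Zp_mulgC.
Qed.

Theorem proposition3p17 (k : closedFieldType) (k_char0 : [pchar k] =i pred0)
    (zeta : nat -> k)
    (zetaP : forall d : nat, (0 < d)%N -> d.-primitive_root (zeta d))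
    (n : nat) (m : 'I_n -> nat) (m_gt0 : forall l : 'I_n, (0 < m l)%N)
    (m_dvd : forall i j : 'I_n, nat_of_ord j = (nat_of_ord i).+1 ->
       (m i %| m j)%N)
    (a : exponents n) (aA : in_A m a)
    (nonabelian : ~ abelian_cocycle (@Phi k n m zeta a))
    (gT : finGroupType) (G : {group gT}) (abG : abelian G)
    (pi : {morphism G >-> zprod m}) (pi_epi : (pi @* G)%g = [set: zprod m]) :
  ~ coboundary3 G (fun g h z : gT => Phi zeta a (pi g) (pi h) (pi z)).
Proof.
move=> cob; apply: nonabelian.
apply: theta_sym_abelian_cocycle => [|x y z]; first exact: zprod_abelian.
have lift w : exists2 g, g \in G & w = pi g.
  have: w \in (pi @* G)%g by rewrite pi_epi inE.
  by case/morphimP=> g _ Gg ->; exists g.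
have [[g Gg ->] [h Gh ->]] := (lift x, lift y); have [i Gi ->] := lift z.
exact: (coboundary3_theta_sym _ _ _ _ abG cob _ _ _ Gg Gh Gi).
Qed.
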